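(* Let $H$ be a complex Hilbert space and let $A$ and $B$ be two unbounded invertible normal operators in $H$, such that all products formed from $A$, $B$ and their adjoints are densely defined. If $BA=AB$, then $BA$ (and $AB$) is normal.
   Context: ''Unbounded operator'' means a linear operator defined on a linear subspace $D(A)$ of $H$, not necessarily bounded. The product of operators is $(BA)x=B(Ax)$ with domain $D(BA)=\{x\in D(A): Ax\in D(B)\}$. $A\subset B$ means $D(A)\subset D(B)$ and $A$, $B$ coincide on $D(A)$. Equality of operators includes equality of domains; in particular $AB=BA$ means $D(AB)=D(BA)$ and $ABx=BAx$ for all $x$ in this common domain. Standing assumption: all operators, together with any operation (sum, product) involving them or their adjoints, are densely defined; bounded operators are defined on all of $H$. An operator $A$ is invertible if there is an everywhere defined bounded operator, denoted $A^{-1}$, on $H$ with $A^{-1}A\subset AA^{-1}=I$. A densely defined operator $A$ is normal if it is closed and $AA^*=A^*A$ (including equality of domains). *)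

(* Defs.v *)
From HB Require Import structures.
From mathcomp Require Import all_boot all_order all_algebra sesquilinear.
From mathcomp Require Import complex.
From mathcomp Require Import all_classical all_reals all_analysis.

Set Implicit Arguments.
Unset Strict Implicit.
Unset Printing Implicit Defensive.

Import Order.TTheory GRing.Theory Num.Theory.
Import numFieldNormedType.Exports.

Local Open Scope classical_set_scope.
Local Open Scope complex_scope.
Local Open Scope ring_scope.

(* [inner] is linear in its first argument and conjugate-linear in the second. *)
HB.mixin Record isHilbert (R : realType) H of CompleteNormedModule R[i] H := {
  inner : {dot H for (@Num.conj R[i])} ;
  sqr_norm_inner : forall x : H, `|x| ^+ 2 = inner x x
}.

#[short(type="hilbertType")]
HB.structure Definition Hilbert (R : realType) :=
  { H of isHilbert R H & CompleteNormedModule R[i] H }.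

Declare Scope operator_scope.
Delimit Scope operator_scope with op.

Section Operators.
Context {R : realType} {H : hilbertType R}.

(* The values of [opfun] outside [dom] are irrelevant: every notion below is
   insensitive to them. In particular, equality of operators is [op_eq], not
   Leibniz equality. *)
Record operator := Operator {
  dom : set H ;
  opfun :> H -> H ;
  dom0 : dom 0 ;
  domP : forall (a : R[i]) x y, dom x -> dom y -> dom (a *: x + y) ;
  opfunP : forall (a : R[i]) x y, dom x -> dom y ->
    opfun (a *: x + y) = a *: opfun x + opfun y
}.

Implicit Types A B T : operator.

Definition op_sub A B := dom A `<=` dom B /\ forall x, dom A x -> A x = B x.

Definition op_eq A B := dom A = dom B /\ forall x, dom A x -> A x = B x.

Definition op_id : operator :=
  @Operator setT idfun I (fun _ _ _ _ _ => I) (fun _ _ _ _ _ => erefl).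

Definition mul_dom B A : set H := [set x | dom A x /\ dom B (A x)].

Lemma opfun0 A : A 0 = 0.
Proof.
have := opfunP 1 (dom0 A) (dom0 A).
by rewrite !scale1r addr0 => /(congr1 (fun v => v - A 0)); rewrite subrr addrK.
Qed.

Fact mul_dom0 B A : mul_dom B A 0.
Proof. by split; [exact: dom0 | rewrite opfun0; exact: dom0]. Qed.

Fact mul_domP B A (a : R[i]) x y :
  mul_dom B A x -> mul_dom B A y -> mul_dom B A (a *: x + y).
Proof.
move=> [xA xB] [yA yB]; split; first exact: domP.
by rewrite opfunP//; exact: domP.
Qed.

Fact mul_opfunP B A (a : R[i]) x y : mul_dom B A x -> mul_dom B A y ->
  B (A (a *: x + y)) = a *: B (A x) + B (A y).
Proof. by move=> [xA xB] [yA yB]; rewrite !opfunP. Qed.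

Definition op_mul B A : operator :=
  Operator (mul_dom0 B A) (@mul_domP B A) (@mul_opfunP B A).

Definition densely_defined A := dense (dom A).

Definition closed_op A :=
  closed [set p : H * H | dom A p.1 /\ p.2 = A p.1].

Definition bounded_op A :=
  exists M : R[i], forall x, dom A x -> `|A x| <= M * `|x|.

Section Adjoint.
Context (A : operator).

Definition adj_rel (y z : H) : Prop :=
  forall x, dom A x -> inner (A x) y = inner x z.

Definition adj_dom : set H := [set y | exists z, adj_rel y z].

(* When [A] is densely defined, the [z] picked here is the only one. *)
Definition adj_fun (y : H) : H := xget 0 (adj_rel y).

Lemma adj_funP y : adj_dom y -> adj_rel y (adj_fun y).
Proof. by case=> z yz; exact: (xgetI 0 yz). Qed.

Lemma adj_rel_linear (a : R[i]) y1 y2 z1 z2 :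
  adj_rel y1 z1 -> adj_rel y2 z2 -> adj_rel (a *: y1 + y2) (a *: z1 + z2).
Proof. by move=> h1 h2 x xA; rewrite !linearP/= h1// h2. Qed.

Fact adj_dom0 : adj_dom 0.
Proof. by exists 0 => x _; rewrite !linear0. Qed.

Fact adj_domP (a : R[i]) y1 y2 :
  adj_dom y1 -> adj_dom y2 -> adj_dom (a *: y1 + y2).
Proof.
by move=> [z1 h1] [z2 h2]; exists (a *: z1 + z2); exact: adj_rel_linear.
Qed.

Context (dA : densely_defined A).

Lemma adj_rel_unique y z1 z2 : adj_rel y z1 -> adj_rel y z2 -> z1 = z2.
Proof.
move=> h1 h2; apply/eqP; rewrite -subr_eq0; set z := z1 - z2.
have z0 x : dom A x -> inner x z = 0.
  by move=> xA; rewrite linearB/= -h1// -h2// subrr.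
apply/negPn/negP => zN0.
have [||x [xz xA]] := dA (O := ball z `|z|).
- by exists z; apply: ballxx; rewrite normr_gt0.
- by apply: ball_open; rewrite normr_gt0.
move: xz; rewrite -ball_normE/= => xz.
have : `|z - x| ^+ 2 < `|z| ^+ 2 by rewrite ltr_pXn2r// nnegrE.
have zx : inner z x = 0 by rewrite hermC /= (z0 _ xA) rmorph0 mulr0.
have pyth : inner (z - x) (z - x) = inner z z + inner x x by exact: hnormBd.
rewrite !sqr_norm_inner pyth gtrDl -sqr_norm_inner => /lt_geF.
by rewrite exprn_ge0.
Qed.

Fact adj_funD (a : R[i]) y1 y2 : adj_dom y1 -> adj_dom y2 ->
  adj_fun (a *: y1 + y2) = a *: adj_fun y1 + adj_fun y2.
Proof.
move=> h1 h2; apply: (@adj_rel_unique (a *: y1 + y2)).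
  exact/adj_funP/adj_domP.
by apply: adj_rel_linear; exact: adj_funP.
Qed.

Definition adjoint : operator := Operator adj_dom0 adj_domP adj_funD.

End Adjoint.

Definition normal T := exists dT : densely_defined T,
  closed_op T /\ op_eq (op_mul T (adjoint dT)) (op_mul (adjoint dT) T).

Definition invertible A := exists S : operator,
  [/\ dom S = setT, bounded_op S,
      op_sub (op_mul S A) (op_mul A S) & op_eq (op_mul A S) op_id].

(* The finite products of one or more factors among [A], [B], [A^*], [B^*].
   Since composition of operators is associative, closing under arbitrary
   binary products covers exactly these words. *)
Inductive product_of A B (dA : densely_defined A) (dB : densely_defined B) :
  operator -> Prop :=
| product_of_l : product_of dA dB A
| product_of_r : product_of dA dB B
| product_of_adjl : product_of dA dB (adjoint dA)
| product_of_adjr : product_of dA dB (adjoint dB)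
| product_of_mul S T : product_of dA dB S -> product_of dA dB T ->
    product_of dA dB (op_mul S T).

End Operators.

Arguments operator {R} H.

Notation "B *op A" := (op_mul B A)
  (at level 40, left associativity) : operator_scope.
Notation "A <=op B" := (op_sub A B) (at level 70) : operator_scope.
Notation "A =op B" := (op_eq A B) (at level 70) : operator_scope.

(* Main.v *)
(* The inverses [S] of [A] and [P] of [B] are bounded normal operators, and
   [BA = AB] says exactly that [S P = P S].  Fuglede's theorem then gives
   [S P^* = P^* S] and [P S^* = S^* P], so [S P] is normal; and an operator with
   a bounded normal inverse [N] is normal: it is closed, its adjoint has inverse
   [N^*], and [N N^* = N^* N] can be inverted.

   Fuglede's theorem is proved by a discrete form of Rosenblum's argument, which
   avoids operator exponentials and Liouville's theorem.  With
   [w = P^* / m] the polynomial [F(z) = (1 + z w)^m S (1 - z w)^m] has linear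
   coefficient [P^* S - S P^*].  Writing [c = z w], and since [S] commutes with
   [c^*], [F(z)] is up to an error that vanishes for large [m] equal to
   [U S U^*] with [U = (1 + c)^m (1 - c^* )^m] nearly unitary.  Hence [F] is
   bounded on the circle of radius [r] by a multiple of the norm of [S]
   independent of [r], and Cauchy's estimate shows that [P^* S - S P^*] is
   smaller than any constant over [r]. *)
Require Import Defs.
From HB Require Import structures.
From mathcomp Require Import all_boot all_order all_algebra sesquilinear.
From mathcomp Require Import complex ring.
From mathcomp Require Import all_classical all_reals all_analysis.

Set Implicit Arguments.
Unset Strict Implicit.
Unset Printing Implicit Defensive.

Import Order.TTheory GRing.Theory Num.Theory.
Import numFieldNormedType.Exports.

Local Open Scope classical_set_scope.
Local Open Scope complex_scope.
Local Open Scope ring_scope.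

(** * Archimedean property and infima for the partial order on [R[i]] *)

Section ComplexOrder.
Context {R : realType}.

Lemma complex_archi (x : R[i]) : 0 <= x -> exists n : nat, x <= n%:R.
Proof.
move=> x0; have /RRe_real <- : x \is Num.real by exact: ger0_real.
exists (Num.bound (complex.Re x)).
rewrite -(rmorph_nat (real_complex R)) lecR; apply/ltW/archi_boundP.
by rewrite -ler0c RRe_real// ger0_real.
Qed.

(** In [R[i]] a nonnegative element is real, so the infimum is taken over the real parts in [R] and
    carried back. *)
Lemma complex_inf (E : set R[i]) : E !=set0 -> (forall x, E x -> 0 <= x) ->
  exists d, (forall x, E x -> d <= x) /\
    forall n : nat, exists2 x, E x & x <= d + n.+1%:R^-1.
Proof.
move=> [x0 Ex0] E0.
have EE x : E x -> (complex.Re x)%:C = x by move=> /E0/ger0_real/RRe_real.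
have iE : has_inf [set complex.Re x | x in E].
  split; first by exists (complex.Re x0), x0.
  by exists 0 => _ [x Ex <-]; rewrite -ler0c EE//; exact: E0.
exists (inf [set complex.Re x | x in E])%:C; split.
  move=> x Ex; rewrite -(EE _ Ex) lecR; apply: ge_inf; first exact: iE.2.
  by exists x.
move=> n; have [|_ [x Ex <-] xn] := inf_adherent (eps := n.+1%:R^-1) _ iE.
  by rewrite invr_gt0.
exists x => //; rewrite -(EE _ Ex) -(rmorph_nat (real_complex R)).
by rewrite -fmorphV -rmorphD lecR ltW.
Qed.

Lemma le_div_nat_eq0 (x C : R[i]) : 0 <= x ->
  (forall n : nat, n%:R * x <= C) -> x = 0.
Proof.
move=> x0 h; apply/eqP; rewrite eq_le x0 andbT.
have C0 : 0 <= C by have := h 0%N; rewrite mul0r.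
apply/negPn/negP => xn0; have {}x0 : 0 < x.
  by rewrite lt_neqAle x0 andbT; apply: contra xn0 => /eqP <-.
have [n Cn] := complex_archi (divr_ge0 C0 (ltW x0)).
have := h n.+1; rewrite -ler_pdivlMr// => /le_trans/(_ Cn).
by rewrite ler_nat ltnn.
Qed.

End ComplexOrder.

(** * Sesquilinearity and the Cauchy-Schwarz inequality *)

Section InnerProduct.
Context {R : realType} {H : hilbertType R}.
Implicit Types (x y z : H) (a : R[i]).

Lemma innerDl x y z : inner (x + y) z = inner x z + inner y z.
Proof. exact: linearDl. Qed.

Lemma innerDr x y z : inner x (y + z) = inner x y + inner x z.
Proof. exact: linearDr. Qed.

Lemma innerNl x y : inner (- x) y = - inner x y.
Proof. exact: linearNl. Qed.

Lemma innerNr x y : inner x (- y) = - inner x y.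
Proof. exact: linearNr. Qed.

Lemma innerZl a x y : inner (a *: x) y = a * inner x y.
Proof. exact: linearZl_LR. Qed.

Lemma innerZr a x y : inner x (a *: y) = Num.conj a * inner x y.
Proof. exact: linearZr_LR. Qed.

Lemma innerC x y : inner x y = Num.conj (inner y x).
Proof. by rewrite hermC expr0 mul1r. Qed.

Lemma inner0l x : inner 0 x = 0.
Proof. by rewrite -(scale0r 0) innerZl mul0r. Qed.

Lemma inner0r x : inner x 0 = 0.
Proof. by rewrite innerC inner0l rmorph0. Qed.

Lemma inner_injr x y : (forall z, inner z x = inner z y) -> x = y.
Proof.
move=> h; apply/eqP; rewrite -subr_eq0 -normr_eq0 -sqrf_eq0 sqr_norm_inner.
by rewrite innerDr innerNr h subrr.
Qed.

Lemma cauchy_schwarz x y : `|inner x y| <= `|x| * `|y|.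
Proof.
have [->|y0] := eqVneq y 0.
  by rewrite [inner x 0](linear0 (inner x)) !normr0 mulr0.
have ny : 0 < `|y| ^+ 2 by rewrite exprn_gt0// normr_gt0.
rewrite -(@ler_pXn2r _ 2)// ?nnegrE ?mulr_ge0// exprMn.
(* [t *: y] is the orthogonal projection of [x] on the line of [y]; the squared norm of
   [x - t *: y], multiplied by that of [y], is the difference of the two squared sides. *)
set t := inner x y / `|y| ^+ 2.
have : 0 <= `|x - t *: y| ^+ 2 by rewrite exprn_ge0.
rewrite sqr_norm_inner innerDl !innerDr !innerNl !innerNr !innerZl !innerZr.
rewrite -!sqr_norm_inner (innerC y x) normCK.
rewrite {}/t fmorph_div/= [Num.conj (`|y| ^+ 2)]conj_Creal; last first.
  by rewrite ger0_real// exprn_ge0.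
set u := inner x y; set s := `|y| ^+ 2 in ny *.
move=> h; rewrite -subr_ge0; have := mulr_ge0 h (ltW ny).
congr (0 <= _); field.
by rewrite gt_eqF.
Qed.

End InnerProduct.

(** * The Riesz representation theorem *)

Section Riesz.
Context {R : realType} {H : hilbertType R}.

Lemma parallelogram (x y : H) :
  `|x - y| ^+ 2 = 2 * `|x| ^+ 2 + 2 * `|y| ^+ 2 - 4 * `|2^-1 *: (x + y)| ^+ 2.
Proof.
rewrite normrZ exprMn ger0_norm ?invr_ge0// !sqr_norm_inner.
by rewrite !innerDl !innerDr !innerNl !innerNr; field.
Qed.

Variables (phi : H -> R[i]) (M : R[i]).
Hypothesis phiP : forall a x y, phi (a *: x + y) = a * phi x + phi y.
Hypothesis phiM : forall x, `|phi x| <= M * `|x|.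

Let phi0 : phi 0 = 0.
Proof. by have := phiP (-1) 0 0; rewrite scaler0 addr0 mulN1r addNr. Qed.

Let phiZ a x : phi (a *: x) = a * phi x.
Proof. by have := phiP a x 0; rewrite phi0 !addr0. Qed.

Let phiB x y : phi (x - y) = phi x - phi y.
Proof. by have := phiP (-1) y x; rewrite scaleN1r mulN1r addrC => ->; rewrite addrC. Qed.

Let phiD x y : phi (x + y) = phi x + phi y.
Proof. by have := phiP 1 x y; rewrite scale1r mul1r. Qed.

(* The squared distance [d] from [0] to the hyperplane [phi = 1] is approached
   by [x_ n]; the parallelogram law makes [x_] a Cauchy sequence. *)
Lemma hyperplane_minimizing_cvg (d : R[i]) (x_ : nat -> H) :
  (forall x, phi x = 1 -> d <= `|x| ^+ 2) -> (forall n, phi (x_ n) = 1) ->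
  (forall n, `|x_ n| ^+ 2 <= d + n.+1%:R^-1) -> cvgn x_.
Proof.
move=> dmin x1 xd; apply: cauchy_cvg.
(* The midpoint of [x_ m] and [x_ n] stays on the hyperplane, so its squared norm is at least [d],
   and the terms in [d] cancel in the parallelogram law. *)
have Pd m n : `|x_ m - x_ n| ^+ 2 <= 2 * m.+1%:R^-1 + 2 * n.+1%:R^-1.
  have dmn : d <= `|2^-1 *: (x_ m + x_ n)| ^+ 2.
    by apply: dmin; rewrite phiZ phiD !x1; field.
  rewrite parallelogram lerBlDr.
  apply: le_trans (_ : 2 * (d + m.+1%:R^-1) + 2 * (d + n.+1%:R^-1) <= _).
    by rewrite lerD// ler_wpM2l.
  apply: le_trans (_ : 2 * m.+1%:R^-1 + 2 * n.+1%:R^-1 + 4 * d <= _).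
    by rewrite le_eqVlt; apply/orP; left; apply/eqP; ring.
  by rewrite lerD2l ler_wpM2l.
apply/cauchy_exP => e e0.
have e2 : 0 < e ^+ 2 by rewrite exprn_gt0.
have [N NP] := complex_archi (divr_ge0 (ler0n R[i] 4) (ltW e2)).
exists (x_ N); suff : \forall n \near \oo, ball (x_ N) e (x_ n) by [].
near=> n; rewrite -ball_normE/=.
rewrite -(@ltr_pXn2r _ 2)// ?nnegrE ?(ltW e0)//.
apply: le_lt_trans (Pd _ _) _.
apply: (@le_lt_trans _ _ (4 * N.+1%:R^-1)).
  rewrite (_ : 4 * _ = 2 * N.+1%:R^-1 + 2 * N.+1%:R^-1); last by ring.
  rewrite lerD2l ler_pM2l// lef_pV2 ?posrE// ler_nat ltnS.
  by near: n; exact: nbhs_infty_ge.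
rewrite ltr_pdivrMr// mulrC -ltr_pdivrMr//.
by apply: le_lt_trans NP _; rewrite ltr_nat.
Unshelve. all: by end_near.
Qed.

(** The limit [l] of a minimizing sequence on [phi = 1] is orthogonal to the kernel of [phi], which
    contains [x - phi x *: l]; so [inner x l] is [phi x] times the squared norm of [l], and
    rescaling [l] gives the representing vector. *)
Lemma riesz : exists z, forall x, phi x = inner x z.
Proof.
have [phi_eq0|] := pselect (forall x, phi x = 0).
  by exists 0 => x; rewrite phi_eq0 inner0r.
move=> /existsNP[x0 /eqP x0N0].
set E := [set `|x| ^+ 2 | x in [set x | phi x = 1]].
have [] := @complex_inf R E.
- by exists (`|(phi x0)^-1 *: x0| ^+ 2), ((phi x0)^-1 *: x0) => //=;
    rewrite phiZ mulVf.
- by move=> _ [x _ <-]; rewrite exprn_ge0.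
move=> d [dE dn].
have {}dE x : phi x = 1 -> d <= `|x| ^+ 2 by move=> x1; apply: dE; exists x.
have {dn} /choice[x_ x_P] (n : nat) :
    exists x, phi x = 1 /\ `|x| ^+ 2 <= d + n.+1%:R^-1.
  by have [_ [x x1 <-] xn] := dn n; exists x.
have x_1 n : phi (x_ n) = 1 by have [] := x_P n.
have x_d n : `|x_ n| ^+ 2 <= d + n.+1%:R^-1 by have [] := x_P n.
have := hyperplane_minimizing_cvg dE x_1 x_d.
set l := limn x_ => cvl.
have near_l e : 0 < e -> \forall n \near \oo, `|l - x_ n| < e.
  by move=> e0; move/cvgrPdist_lt : cvl; exact.
have small (a C : R[i]) : 0 <= a -> 0 <= C ->
    (forall e, 0 < e -> a <= C * e) -> a = 0.
  move=> a0 C0 h; apply: (@le_div_nat_eq0 _ _ C) => // -[|n].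
    by rewrite mul0r.
  by rewrite mulrC -ler_pdivlMr// h// invr_gt0.
have M0 : 0 <= M.
  have := le_trans (normr_ge0 _) (phiM x0); rewrite pmulr_lge0//.
  rewrite normr_gt0; apply: contraNneq x0N0 => ->.
  by rewrite phi0.
have l1 : phi l = 1.
  apply/eqP; rewrite -subr_eq0 -normr_eq0; apply/eqP.
  apply: (small _ M) => // e e0.
  have [n ne] := filter_ex (near_l _ e0).
  rewrite -(x_1 n) -phiB (le_trans (phiM _))//.
  by rewrite ler_wpM2l// ltW.
(* Minimality along [x_ n - t y] bounds [inner (x_ n) y]. *)
have ort y : phi y = 0 -> inner l y = 0.
  move=> y0; have [->|yN0] := eqVneq y 0; first by rewrite inner0r.
  have ny : 0 < `|y| ^+ 2 by rewrite exprn_gt0// normr_gt0.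
  have xy n : `|inner (x_ n) y| ^+ 2 <= n.+1%:R^-1 * `|y| ^+ 2.
    set t := inner (x_ n) y / `|y| ^+ 2.
    have := dE (x_ n - t *: y); rewrite phiB phiZ y0 mulr0 subr0 x_1.
    move=> /(_ erefl).
    rewrite sqr_norm_inner innerDl !innerDr !innerNl !innerNr !innerZl !innerZr.
    rewrite -!sqr_norm_inner (innerC y) [`|inner (x_ n) y| ^+ 2]normCK.
    rewrite {}/t fmorph_div/= [Num.conj (`|y| ^+ 2)]conj_Creal; last first.
      by rewrite ger0_real// exprn_ge0.
    set u := inner _ y; set s := `|y| ^+ 2 in ny *; set q := `|x_ n| ^+ 2.
    move=> h; rewrite -ler_pdivrMr//.
    have := lerD h (x_d n).
    rewrite -/q -subr_ge0 => h'; rewrite -subr_ge0; apply: le_trans h' _.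
    by rewrite le_eqVlt; apply/orP; left; apply/eqP; field; rewrite gt_eqF// nat1r pnatr_eq0.
  apply/eqP; rewrite -normr_eq0; apply/eqP.
  apply: (small _ (2 * `|y|)) => //.
  move=> e e0.
  have e2 : 0 < e ^+ 2 by rewrite exprn_gt0.
  have [N NP] : exists N : nat, (e ^+ 2)^-1 <= N%:R.
    by apply: complex_archi; rewrite invr_ge0 ltW.
  near \oo => n.
  rewrite -[l](subrK (x_ n)) innerDl (le_trans (ler_normD _ _))//.
  rewrite [2]mulr2n mulrDl mul1r mulrDl lerD//.
    rewrite (le_trans (cauchy_schwarz _ _))// mulrC ler_wpM2l// ltW//.
    by near: n; exact: near_l.
  rewrite -(@ler_pXn2r _ 2)// ?nnegrE ?mulr_ge0 ?(ltW e0)//.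
  rewrite (le_trans (xy n))// exprMn mulrC ler_wpM2l ?exprn_ge0//.
  rewrite invf_ple ?posrE// (le_trans NP)// ler_nat.
  by apply: leqW; near: n; exact: nbhs_infty_ge.
exists ((`|l| ^+ 2)^-1 *: l) => x.
have lN0 : `|l| ^+ 2 != 0.
  rewrite sqrf_eq0 normr_eq0; apply: contra_eqN l1 => /eqP ->.
  by rewrite phi0 eq_sym oner_eq0.
have := ort (x - phi x *: l); rewrite phiB phiZ l1 mulr1 subrr => /(_ erefl).
rewrite innerDr innerNr innerZr -sqr_norm_inner => /eqP.
rewrite subr_eq0 => /eqP lx.
rewrite innerC innerZl lx mulrC mulfK//.
by rewrite conjCK.
Unshelve. all: by end_near.
Qed.
End Riesz.

(** * Cauchy estimates for vector-valued polynomials *)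

Section CauchyEstimate.
Context {R : realType} {V : normedModType R[i]}.
Implicit Types (a : nat -> V) (s M z : R[i]).

Let vsum a z n : V := \sum_(i < n) z ^+ i *: a i.

Let vsum_even_odd a z n :
  vsum a z n.*2 =
    vsum (fun i => a i.*2) (z ^+ 2) n + z *: vsum (fun i => a i.*2.+1) (z ^+ 2) n.
Proof.
elim: n => [|n IH]; first by rewrite /vsum !big_ord0 scaler0 addr0.
rewrite doubleS /vsum !big_ord_recr/= -/(vsum _ _ _) IH -/(vsum _ _ _).
rewrite -/(vsum (fun i => a i.*2.+1) _ _) scalerDr scalerA -!exprM -exprS.
by rewrite mul2n -!addrA; congr (_ + _); rewrite addrCA.
Qed.

(** The even and odd parts are half the sum and half the difference of the values at [z] and [- z],
    which lie on the same circle. *)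
Let vsum_parts a s M z n : 0 <= s -> `|z| = s ->
  (forall z, `|z| = s -> `|vsum a z n.*2| <= M) ->
  `|vsum (fun i => a i.*2) (z ^+ 2) n| <= M /\
  s * `|vsum (fun i => a i.*2.+1) (z ^+ 2) n| <= M.
Proof.
move=> s0 zs h; have h1 := h _ zs.
have := h (- z); rewrite normrN => /(_ zs) h2.
move: h1 h2; rewrite !vsum_even_odd sqrrN.
set e := vsum _ _ _; set o := vsum _ _ _ => h1 h2.
have half (x : V) : x *+ 2 = 2 *: x by rewrite scaler_nat.
split.
- rewrite -(@ler_pM2l _ 2)//.
  rewrite [X in X <= _](_ : _ = `|(e + z *: o) + (e + (- z) *: o)|).
    by rewrite (le_trans (ler_normD _ _))// mulr2n mulrDl mul1r lerD.
  rewrite scaleNr addrACA subrr addr0 -mulr2n half normrZ.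
  by rewrite ger0_norm.
- rewrite -(@ler_pM2l _ 2)//.
  rewrite [X in X <= _](_ : _ = `|(e + z *: o) - (e + (- z) *: o)|).
    by rewrite (le_trans (ler_normB _ _))// mulr2n mulrDl mul1r lerD.
  rewrite scaleNr opprD opprK addrACA subrr add0r -mulr2n half !normrZ zs.
  by rewrite ger0_norm.
Qed.

(* Averaging over [z] and [- z] halves the degree, so no root of unity of
   higher order is needed. *)
Lemma cauchy_coef0 k a s M : 0 <= s ->
  (forall z, `|z| = s -> `|\sum_(i < 2 ^ k) z ^+ i *: a i| <= M) -> `|a 0%N| <= M.
Proof.
elim: k a s => [|k IH] a s s0 h.
  have := h s; rewrite ger0_norm// expn0 big_ord1 expr0 scale1r.
  exact.
apply: (IH (fun i => a i.*2) (s ^+ 2)); first exact: exprn_ge0.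
move=> z zs.
(* The even part is a polynomial in the square of the variable, so the induction moves to radius
   [s ^+ 2], each point of which is the square of a point at radius [s]. *)
have zz : `|sqrtC z| = s.
  by apply/eqP; rewrite -(@eqrXn2 _ 2)// -normrX sqrtCK; apply/eqP.
have := vsum_parts (n := 2 ^ k) s0 zz; rewrite -mul2n -expnS sqrtCK.
by move=> /(_ a M h)[].
Qed.

(** [a 1] is the constant coefficient of the odd part divided by the variable; the factor [s] is
    absorbed into the coefficients so that the previous estimate applies with the same [M]. *)
Lemma cauchy_coef1 k a s M : 0 <= s ->
  (forall z, `|z| = s -> `|\sum_(i < 2 ^ k.+1) z ^+ i *: a i| <= M) ->
  s * `|a 1%N| <= M.
Proof.
move=> s0 h.
have /eqP <- : `|s *: a 1%N| == s * `|a 1%N| by rewrite normrZ ger0_norm.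
apply: (@cauchy_coef0 k (fun i => s *: a i.*2.+1) (s ^+ 2)).
  exact: exprn_ge0.
move=> z zs.
have zz : `|sqrtC z| = s.
  by apply/eqP; rewrite -(@eqrXn2 _ 2)// -normrX sqrtCK; apply/eqP.
have := vsum_parts (n := 2 ^ k) s0 zz; rewrite -mul2n -expnS sqrtCK.
move=> /(_ a M h)[_]; rewrite -{1}(ger0_norm s0) -normrZ scaler_sumr.
by under eq_bigr do rewrite scalerA mulrC -scalerA.
Qed.

End CauchyEstimate.

(** A converse to Bernoulli's inequality for small [m%:R * t]: the induction step comes down to
    [0 <= t * (1 - 2 * (m%:R * t))]. *)
Lemma exp1D_le (F : numFieldType) (t : F) (m : nat) : 0 <= t ->
  2 * (m%:R * t) <= 1 -> (1 + t) ^+ m <= 1 + 2 * (m%:R * t).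
Proof.
move=> t0; elim: m => [|m IH] h; first by rewrite expr0 mul0r mulr0 addr0.
have mt : 2 * (m%:R * t) <= 1.
  by apply: le_trans h; rewrite ler_wpM2l// ler_wpM2r// ler_nat.
rewrite exprSr; apply: (@le_trans _ _ ((1 + 2 * (m%:R * t)) * (1 + t))).
  by rewrite ler_wpM2r ?IH// addr_ge0.
rewrite -subr_ge0 [X in 0 <= X](_ : _ = t * (1 - 2 * (m%:R * t))); last first.
  by rewrite -[m.+1]addn1 natrD; ring.
by rewrite mulr_ge0// subr_ge0.
Qed.

(** * The ring of everywhere defined operators with an adjoint *)

Section Adjointable.
Context {R : realType} {H : hilbertType R}.

(** Linearity follows from the adjoint identity, and the adjoint is determined by the map. Bundling
    both yields a ring with involution, where commutation is [GRing.comm]; boundedness is tracked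
    separately by [adj_bound]. *)
Record adjointable := Adjointable {
  adjointable_fun :> H -> H;
  adjointable_adj : H -> H;
  adjointableP : forall x y,
    inner (adjointable_fun x) y = inner x (adjointable_adj y) }.

Implicit Types f g h : adjointable.

Lemma adjointable_eq f g : f =1 g -> f = g.
Proof.
case: f g => [f fs fP] [g gs gP] /= /funext fg; subst g.
have : fs = gs by apply/funext => y; apply: inner_injr => x; rewrite -fP gP.
by move=> ?; subst gs; congr Adjointable; exact: Prop_irrelevance.
Qed.

Lemma adjointable_linear f a x y : f (a *: x + y) = a *: f x + f y.
Proof.
apply: inner_injr => z; rewrite [LHS]innerC [RHS]innerC; congr Num.conj.
by rewrite adjointableP !innerDl !innerZl -!adjointableP.
Qed.

Lemma adjointableD f x y : f (x + y) = f x + f y.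
Proof. by have := adjointable_linear f 1 x y; rewrite !scale1r. Qed.

Lemma adjointable0 f : f 0 = 0.
Proof. by apply: (@addrI _ (f 0)); rewrite -adjointableD !addr0. Qed.

Lemma adjointableZ f a x : f (a *: x) = a *: f x.
Proof. by have := adjointable_linear f a x 0; rewrite adjointable0 !addr0. Qed.

Lemma adjointable_sum f n (u : 'I_n -> H) : f (\sum_i u i) = \sum_i f (u i).
Proof. exact: (big_morph f (adjointableD f) (adjointable0 f)). Qed.

Definition adj_star f : adjointable.
Proof.
exists (adjointable_adj f) f => x y.
by rewrite innerC -adjointableP -innerC.
Defined.

Lemma adj_starP f x y : inner (f x) y = inner x (adj_star f y).
Proof. exact: adjointableP. Qed.

Let add0 : adjointable.
Proof. by exists (fun=> 0) (fun=> 0) => x y; rewrite inner0l inner0r. Defined.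

Let addN f : adjointable.
Proof.
by exists (fun x => - f x) (fun x => - adj_star f x) => x y;
  rewrite innerNl innerNr adj_starP.
Defined.

Let addD f g : adjointable.
Proof.
by exists (fun x => f x + g x) (fun x => adj_star f x + adj_star g x) => x y;
  rewrite innerDl innerDr !adj_starP.
Defined.

Let mul1 : adjointable.
Proof. by exists id id. Defined.

Let mulD f g : adjointable.
Proof.
by exists (f \o g) (adj_star g \o adj_star f) => x y /=; rewrite !adj_starP.
Defined.

HB.instance Definition _ := gen_eqMixin adjointable.
HB.instance Definition _ := gen_choiceMixin adjointable.

Let addDA : associative addD.
Proof. by move=> f g h; apply: adjointable_eq => x /=; rewrite addrA. Qed.
Let addDC : commutative addD.
Proof. by move=> f g; apply: adjointable_eq => x /=; rewrite addrC. Qed.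
Let add0D : left_id add0 addD.
Proof. by move=> f; apply: adjointable_eq => x /=; rewrite add0r. Qed.
Let addND : left_inverse add0 addN addD.
Proof. by move=> f; apply: adjointable_eq => x /=; rewrite addNr. Qed.

HB.instance Definition _ := GRing.isZmodule.Build adjointable
  addDA addDC add0D addND.

Let mulDA : associative mulD.
Proof. by move=> f g h; exact: adjointable_eq. Qed.
Let mul1D : left_id mul1 mulD.
Proof. by move=> f; exact: adjointable_eq. Qed.
Let mulD1 : right_id mul1 mulD.
Proof. by move=> f; exact: adjointable_eq. Qed.
Let mulDDl : left_distributive mulD addD.
Proof. by move=> f g h; exact: adjointable_eq. Qed.
Let mulDDr : right_distributive mulD addD.
Proof. by move=> f g h; apply: adjointable_eq => x /=; rewrite adjointableD. Qed.

HB.instance Definition _ := GRing.Zmodule_isPzRing.Build adjointable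
  mulDA mul1D mulD1 mulDDl mulDDr.

Lemma adjE0 x : (0 : adjointable) x = 0. Proof. by []. Qed.
Lemma adjEN f x : (- f) x = - f x. Proof. by []. Qed.
Lemma adjED f g x : (f + g) x = f x + g x. Proof. by []. Qed.
Lemma adjE1 x : (1 : adjointable) x = x. Proof. by []. Qed.
Lemma adjEM f g x : (f * g) x = f (g x). Proof. by []. Qed.

(** Scalars enter as central elements, so that scalar multiples are ring products. *)
Definition adj_scal (a : R[i]) : adjointable.
Proof.
by exists (fun x => a *: x) (fun x => Num.conj a *: x) => x y;
  rewrite innerZl innerZr conjCK.
Defined.

Lemma adj_scalC a f : adj_scal a * f = f * adj_scal a.
Proof. by apply: adjointable_eq => x; rewrite !adjEM /= adjointableZ. Qed.

Lemma adj_scalM a b : adj_scal a * adj_scal b = adj_scal (a * b).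
Proof. by apply: adjointable_eq => x; rewrite adjEM /= scalerA. Qed.

Lemma adj_starK : involutive adj_star.
Proof. by move=> f; exact: adjointable_eq. Qed.

Lemma adj_starM f g : adj_star (f * g) = adj_star g * adj_star f.
Proof. exact: adjointable_eq. Qed.

Lemma adj_starD f g : adj_star (f + g) = adj_star f + adj_star g.
Proof. exact: adjointable_eq. Qed.

Lemma adj_starN f : adj_star (- f) = - adj_star f.
Proof. exact: adjointable_eq. Qed.

Lemma adj_star1 : adj_star 1 = 1.
Proof. exact: adjointable_eq. Qed.

Lemma adj_starX f n : adj_star (f ^+ n) = adj_star f ^+ n.
Proof.
by elim: n => [|n IH]; [exact: adj_star1|rewrite exprSr exprS adj_starM IH].
Qed.

Lemma adj_star_scal a : adj_star (adj_scal a) = adj_scal (Num.conj a).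
Proof. exact: adjointable_eq. Qed.

Definition adj_bound (M : R[i]) f := forall x, `|f x| <= M * `|x|.

Lemma adj_boundW (M N : R[i]) f : adj_bound M f -> M <= N -> adj_bound N f.
Proof. by move=> h MN x; rewrite (le_trans (h x))// ler_wpM2r. Qed.

Lemma adj_boundD M N f g :
  adj_bound M f -> adj_bound N g -> adj_bound (M + N) (f + g).
Proof.
by move=> hf hg x; rewrite adjED (le_trans (ler_normD _ _))// mulrDl lerD.
Qed.

Lemma adj_boundN M f : adj_bound M f -> adj_bound M (- f).
Proof. by move=> h x; rewrite adjEN normrN. Qed.

Lemma adj_boundM M N f g : 0 <= M ->
  adj_bound M f -> adj_bound N g -> adj_bound (M * N) (f * g).
Proof.
move=> M0 hf hg x; rewrite adjEM (le_trans (hf _))// -mulrA.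
by rewrite ler_wpM2l.
Qed.

Lemma adj_bound1 : adj_bound 1 1.
Proof. by move=> x; rewrite mul1r. Qed.

Lemma adj_boundX M f n : 0 <= M -> adj_bound M f -> adj_bound (M ^+ n) (f ^+ n).
Proof.
move=> M0 h; elim: n => [|n IH]; first exact: adj_bound1.
by rewrite !exprS; exact: adj_boundM.
Qed.

Lemma adj_bound_scal a : adj_bound `|a| (adj_scal a).
Proof. by move=> x; rewrite /= normrZ. Qed.

(** With [v = adj_star f x], the squared norm of [v] is [inner (f v) x]; Cauchy-Schwarz and division
    by the norm of [v] conclude. *)
Lemma adj_bound_star M f : 0 <= M -> adj_bound M f -> adj_bound M (adj_star f).
Proof.
move=> M0 h x; have [->|fx0] := eqVneq (adj_star f x) 0.
  by rewrite normr0 mulr_ge0.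
rewrite -(@ler_pM2r _ `|adj_star f x|) ?normr_gt0// -expr2 sqr_norm_inner.
rewrite -adj_starP; have := cauchy_schwarz (f (adj_star f x)) x.
rewrite adj_starP -sqr_norm_inner ger0_norm ?exprn_ge0// => /le_trans; apply.
by rewrite mulrAC ler_wpM2r.
Qed.

Lemma adj_bound_sqr M f : 0 <= M ->
  adj_bound (M ^+ 2) (adj_star f * f) -> adj_bound M f.
Proof.
move=> M0 h x; rewrite -(@ler_pXn2r _ 2)// ?nnegrE ?mulr_ge0// exprMn.
rewrite sqr_norm_inner adj_starP -adjEM.
(* Cauchy-Schwarz bounds only the modulus; this inner product equals its modulus because it is the
   squared norm of [f x]. *)
have -> : inner x ((adj_star f * f) x) = `|inner x ((adj_star f * f) x)|.
  by rewrite ger0_norm// adjEM -adj_starP -sqr_norm_inner exprn_ge0.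
rewrite (le_trans (cauchy_schwarz _ _))// mulrC [`|x| ^+ 2]expr2 mulrA.
by rewrite ler_wpM2r.
Qed.

End Adjointable.
Arguments adjointable {R} H.

(** * Fuglede's theorem for bounded operators *)

Section Fuglede.
Context {R : realType} {H : hilbertType R}.
Implicit Types (c S P w L : adjointable H).

Lemma adj_bound_1D t c : adj_bound t c -> adj_bound (1 + t) (1 + c).
Proof. exact/adj_boundD/adj_bound1. Qed.

Lemma adj_bound_1B t c : adj_bound t c -> adj_bound (1 + t) (1 - c).
Proof. by move=> h; apply: adj_bound_1D; exact: adj_boundN. Qed.

(** The operator and its bound satisfy parallel recurrences: passing from [m] to [m.+1] adds
    [c * (1 - c) ^+ m] to one and [t * (1 + t) ^+ m] to the other. *)
Lemma adj_bound_1B_exp t c m : 0 <= t -> adj_bound t c ->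
  adj_bound ((1 + t) ^+ m - 1) (1 - (1 - c) ^+ m).
Proof.
move=> t0 h; elim: m => [|m IH].
  by rewrite !expr0 !subrr => x; rewrite mul0r adjE0 normr0.
rewrite (_ : 1 - _ = (1 - (1 - c) ^+ m) + c * (1 - c) ^+ m); last first.
  by rewrite exprS mulrBl mul1r opprB addrAC addrA.
rewrite (_ : (1 + t) ^+ m.+1 - 1 = ((1 + t) ^+ m - 1) + t * (1 + t) ^+ m).
  apply: adj_boundD => //; apply: adj_boundM => //.
  by apply: adj_boundX; [rewrite addr_ge0|exact: adj_bound_1B].
by rewrite exprS mulrDl mul1r addrAC.
Qed.

Lemma comm_1D c d : GRing.comm c d -> GRing.comm (1 + c) (1 + d).
Proof.
move=> cd; apply: commrD; first exact: commr1.
by apply/commr_sym/commrD; [exact: commr1|exact: commr_sym].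
Qed.

Lemma comm_1BD c d : GRing.comm c d -> GRing.comm (1 - c) (1 + d).
Proof. by move=> cd; apply: comm_1D; apply/commr_sym/commrN/commr_sym. Qed.

Lemma exp_1DB c m : (1 + c) ^+ m * (1 - c) ^+ m = (1 - c ^+ 2) ^+ m.
Proof.
have cc : GRing.comm (1 + c) (1 - c) by apply: comm_1D; apply: commrN.
rewrite -exprMn_comm//; congr (_ ^+ _).
by rewrite mulrBr mulr1 mulrDl mul1r opprD addrA addrK expr2.
Qed.

Lemma exp_1BD c m : (1 - c) ^+ m * (1 + c) ^+ m = (1 - c ^+ 2) ^+ m.
Proof. by have := exp_1DB (- c) m; rewrite opprK sqrrN. Qed.

(* [(1 + c) ^+ m * (1 - c^* ) ^+ m] approximates the unitary operator
   exp(m (c - c^* )). *)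
Lemma adj_bound_unitary t c m : 0 <= t -> adj_bound t c ->
  GRing.comm c (adj_star c) ->
  adj_bound ((1 + t ^+ 2) ^+ m) ((1 + c) ^+ m * (1 - adj_star c) ^+ m).
Proof.
move=> t0 h cc; set d := adj_star c.
have hd : adj_bound t d by exact: adj_bound_star.
have dE : adj_star d = c by rewrite /d adj_starK.
have t20 : 0 <= 1 + t ^+ 2 by rewrite addr_ge0// exprn_ge0.
apply: adj_bound_sqr; first exact: exprn_ge0.
rewrite adj_starM !adj_starX !(adj_starD, adj_starN) adj_star1 dE -/d.
rewrite mulrA -[X in X * _]mulrA.
have -> : (1 + d) ^+ m * (1 + c) ^+ m = (1 + c) ^+ m * (1 + d) ^+ m.
  by apply/commrX/commr_sym/commrX/comm_1D.
rewrite !mulrA -mulrA exp_1DB exp_1BD.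
rewrite expr2; apply: adj_boundM; first exact: exprn_ge0.
- by apply: adj_boundX => //; apply: adj_bound_1B; exact: adj_boundX.
- by apply: adj_boundX => //; apply: adj_bound_1B; exact: adj_boundX.
Qed.

Lemma adj_bound_conj s t c S m : 0 <= s -> 0 <= t ->
  adj_bound t c -> adj_bound s S ->
  GRing.comm c (adj_star c) -> GRing.comm S (adj_star c) ->
  adj_bound ((1 + t ^+ 2) ^+ m * s * (1 + t ^+ 2) ^+ m +
             (1 + t) ^+ m * s * ((1 + t ^+ 2) ^+ m - 1) * (1 + t) ^+ m)
    ((1 + c) ^+ m * S * (1 - c) ^+ m).
Proof.
move=> s0 t0 hc hS cc Sc; set d := adj_star c.
have hd : adj_bound t d by exact: adj_bound_star.
have t20 : 0 <= 1 + t ^+ 2 by rewrite addr_ge0// exprn_ge0.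
have t10 : 0 <= 1 + t by rewrite addr_ge0.
(* Insert [(1 - d ^+ 2) ^+ m = (1 - d) ^+ m * (1 + d) ^+ m] to the right of [S] and move the first
   factor across [S], which commutes with [d]. This gives a conjugate of [S] by a nearly unitary
   element; the second summand is the error. *)
rewrite (_ : _ * S * _ = (1 + c) ^+ m * (1 - d) ^+ m * S *
    ((1 + d) ^+ m * (1 - c) ^+ m) +
    (1 + c) ^+ m * S * (1 - (1 - d ^+ 2) ^+ m) * (1 - c) ^+ m).
  apply: adj_boundD.
    apply: adj_boundM; [by rewrite mulr_ge0// exprn_ge0| |].
      by apply: adj_boundM; [exact: exprn_ge0|exact: (adj_bound_unitary m t0 hc cc)|].
    rewrite (_ : _ * _ = adj_star ((1 + c) ^+ m * (1 - d) ^+ m)).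
      apply: adj_bound_star; first exact: exprn_ge0.
      exact: (adj_bound_unitary m t0 hc cc).
    rewrite adj_starM !adj_starX !(adj_starD, adj_starN) adj_star1 adj_starK -/d.
    apply/commrX/commr_sym/commrX.
    exact: comm_1BD.
  have hX : adj_bound ((1 + t) ^+ m) ((1 - c) ^+ m).
    by apply: adj_boundX => //; exact: adj_bound_1B.
  have hY : adj_bound ((1 + t) ^+ m) ((1 + c) ^+ m).
    by apply: adj_boundX => //; exact: adj_bound_1D.
  have hZ : adj_bound ((1 + t ^+ 2) ^+ m - 1) (1 - (1 - d ^+ 2) ^+ m).
    apply: adj_bound_1B_exp; first exact: exprn_ge0.
    exact: adj_boundX.
  have q0 : 0 <= (1 + t) ^+ m by exact: exprn_ge0.
  have k0 : 0 <= (1 + t ^+ 2) ^+ m - 1.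
    by rewrite subr_ge0 exprn_ege1// lerDl exprn_ge0.
  apply: adj_boundM (hX); first by rewrite !mulr_ge0.
  apply: adj_boundM (hZ); first by rewrite mulr_ge0.
  exact: adj_boundM hY hS.
have -> : (1 + c) ^+ m * (1 - d) ^+ m * S * ((1 + d) ^+ m * (1 - c) ^+ m) =
    (1 + c) ^+ m * S * (1 - d ^+ 2) ^+ m * (1 - c) ^+ m.
  rewrite !mulrA -[_ * (1 - d) ^+ m * S]mulrA.
  have -> : (1 - d) ^+ m * S = S * (1 - d) ^+ m.
    by apply/commr_sym/commrX/commrD; [exact: commr1|exact: commrN].
  rewrite !mulrA -[_ * _ * (1 + d) ^+ m]mulrA.
  by rewrite exp_1BD.
by rewrite -mulrDl -mulrDr addrCA subrr addr0 mulr1.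
Qed.

(** A polynomial in [z] with its two lowest coefficients. Requiring the expansion for every [n] from
    [N] on makes the tail of [a] vanish, so the length can be padded to a power of two for the
    Cauchy estimate. *)
Definition vpoly (f : R[i] -> H) (c0 c1 : H) :=
  exists a : nat -> H, [/\ a 0%N = c0, a 1%N = c1 &
    exists N, forall n, (N <= n)%N ->
      forall z, f z = \sum_(i < n) z ^+ i *: a i].

Lemma vpoly_cst u : vpoly (fun=> u) u 0.
Proof.
exists (fun i => if i is 0%N then u else 0); split => //; exists 1%N.
case=> // n _ z; rewrite big_ord_recl expr0 scale1r big1 ?addr0// => i _.
by rewrite scaler0.
Qed.

Lemma vpoly_app L f (c0 c1 : H) :
  vpoly f c0 c1 -> vpoly (fun z => L (f z)) (L c0) (L c1).
Proof.
move=> [a [<- <- [N fa]]]; exists (L \o a); split => //; exists N => n Nn z.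
rewrite (fa _ Nn) adjointable_sum; apply: eq_bigr => i _.
by rewrite adjointableZ.
Qed.

Lemma vpoly_1Dz w f (c0 c1 : H) : vpoly f c0 c1 ->
  vpoly (fun z => (1 + adj_scal z * w) (f z)) c0 (c1 + w c0).
Proof.
move=> [a [<- <- [N fa]]].
exists (fun i => a i + if i is j.+1 then w (a j) else 0).
split => //; first by rewrite addr0.
(* Multiplication by [z] shifts the coefficients: [n.+1] terms of the product use only [n] terms of
   [f], hence the threshold [N.+1]. *)
exists N.+1; case=> // n Nn z; rewrite adjED adjE1 adjEM /=.
under eq_bigr do rewrite scalerDr.
rewrite big_split /= (fa n.+1) 1?leqW//; congr (_ + _).
rewrite -(fa n.+1) 1?leqW// (fa n)// [RHS]big_ord_recl scaler0 add0r.
rewrite adjointable_sum scaler_sumr; apply: eq_bigr => i _.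
by rewrite lift0 adjointableZ scalerA exprS.
Qed.

Lemma vpoly_1Dz_exp w f (c0 c1 : H) m : vpoly f c0 c1 ->
  vpoly (fun z => ((1 + adj_scal z * w) ^+ m) (f z)) c0 (c1 + w c0 *+ m).
Proof.
move=> h; elim: m => [|m IH]; first by rewrite mulr0n addr0.
rewrite mulrSr addrA; have := vpoly_1Dz w IH.
by under [X in vpoly X]eq_fun do rewrite -adjEM -exprS.
Qed.

Lemma vpoly_coef1 f (c0 c1 : H) s M : 0 <= s -> vpoly f c0 c1 ->
  (forall z, `|z| = s -> `|f z| <= M) -> s * `|c1| <= M.
Proof.
move=> s0 [a [_ <- [N fa]]] h; apply: (@cauchy_coef1 _ _ N) => // z zs.
by rewrite -fa ?h// (leq_trans (ltnW (ltn_expl N (isT : 1 < 2)%N)))// leq_exp2l.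
Qed.

Lemma fuglede_conj_bound (s p r : nat) S P : adj_bound s%:R S ->
  adj_bound p%:R P -> GRing.comm P (adj_star P) -> GRing.comm S P ->
  exists m : nat, forall z : R[i], `|z| = r%:R ->
    adj_bound (5 * s%:R)
     ((1 + adj_scal z * (adj_scal m.+1%:R^-1 * adj_star P)) ^+ m.+1 * S *
      (1 - adj_scal z * (adj_scal m.+1%:R^-1 * adj_star P)) ^+ m.+1).
Proof.
move=> hS hP PP SP.
(* [rho] bounds the norm of [z] times that of [P], so [t = rho / m.+1] bounds [c]. Splitting the
   exponent as [n * k] serves two purposes: [n > 2 * rho] gives [(1 + t) ^+ k <= 2], hence
   [L <= 2 ^+ n]; and [k] is large enough for [K - 1 <= (4 ^+ n)^-1]. So the error is at most [s],
   while [K <= 2] bounds the main term by [4 * s]. *)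
set rho := (r * p)%N; set n := (2 * rho).+1; set k := (2 * rho ^ 2 * 4 ^ n).+1.
have [m mE] : exists m, m.+1 = (n * k)%N by exists (n * k).-1; rewrite prednK.
exists m => z zr; set c := adj_scal z * _.
have m0 : m.+1%:R != 0 :> R[i] by rewrite pnatr_eq0.
have n0 : n%:R != 0 :> R[i] by rewrite pnatr_eq0.
have k0 : k%:R != 0 :> R[i] by rewrite pnatr_eq0.
have cE' : c = adj_scal (z / m.+1%:R) * adj_star P.
  by rewrite /c mulrA adj_scalM.
have cE : adj_star c = adj_scal (Num.conj (z / m.+1%:R)) * P.
  by rewrite cE' adj_starM adj_starK adj_star_scal adj_scalC.
pose t : R[i] := rho%:R / m.+1%:R.
have t0 : 0 <= t by rewrite divr_ge0.
have hc : adj_bound t c.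
  rewrite cE' (_ : t = `|z / m.+1%:R| * p%:R).
    apply: adj_boundM; [by []|exact: adj_bound_scal|exact: adj_bound_star].
  by rewrite normrM zr ger0_norm ?invr_ge0// /t /rho natrM mulrAC.
have comm_scal a b f g : GRing.comm f g ->
    GRing.comm (adj_scal a * f) (adj_scal b * g) :> Prop.
  move=> fg; have sc x h : GRing.comm (adj_scal x) h by exact: adj_scalC.
  apply: commrM; first exact/commr_sym/sc.
  by apply/commr_sym/commrM; [exact/commr_sym/sc|exact/commr_sym].
have cc : GRing.comm c (adj_star c).
  by rewrite cE cE'; apply: comm_scal; exact: commr_sym.
have Sc : GRing.comm S (adj_star c).
  by rewrite cE; apply: commrM => //; apply/commr_sym; exact: adj_scalC.
have := @adj_bound_conj s%:R t c S m.+1 (ler0n _ _) t0 hc hS cc Sc.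
move/adj_boundW; apply.
set K := (1 + t ^+ 2) ^+ m.+1.
have K1 : 1 <= K by rewrite exprn_ege1// lerDl exprn_ge0.
have KP : K - 1 <= (4 ^+ n)^-1.
  have tm : 2 * (m.+1%:R * t ^+ 2) <= (4 ^+ n)^-1.
    rewrite (_ : _ * _ = (2 * rho ^ 2)%:R / m.+1%:R); last first.
      by rewrite /t natrM natrX; field; rewrite nat1r.
    rewrite ler_pdivrMr ?ltr0n// mulrC ler_pdivlMr ?exprn_gt0//.
    rewrite -natrX -natrM ler_nat mE (leq_trans (leqnSn _))//.
    by rewrite leq_pmull.
  rewrite lerBlDl (le_trans _ (_ : 1 + 2 * (m.+1%:R * t ^+ 2) <= _)) ?lerD2l//.
  apply: exp1D_le; first exact: exprn_ge0.
  by rewrite (le_trans tm)// invf_le1 ?exprn_gt0// exprn_ege1// ler1n.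
have K2 : K <= 2.
  rewrite -[K](subrK 1) [2]mulr2n lerD// (le_trans KP)//.
  by rewrite invf_le1 ?exprn_gt0// exprn_ege1// ler1n.
have Lm : (1 + t) ^+ m.+1 <= 2 ^+ n.
  have tk : 2 * (k%:R * t) <= 1.
    rewrite (_ : _ * _ = (2 * rho)%:R / n%:R); last first.
      by rewrite /t mE !natrM; field; rewrite k0 n0.
    by rewrite ler_pdivrMr ?ltr0n// mul1r ler_nat.
  rewrite mE mulnC exprM lerXn2r ?nnegrE ?exprn_ge0 ?addr_ge0//.
  by rewrite (le_trans (exp1D_le t0 tk))// [2 in leRHS]mulr2n lerD2l.
set L := (1 + t) ^+ m.+1 in Lm *.
have L0 : 0 <= L by rewrite exprn_ge0// addr_ge0.
rewrite (_ : 5 = 4 + 1 :> R[i]); last by rewrite -natr1.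
rewrite mulrDl; apply: lerD.
  rewrite mulrAC ler_wpM2r// (_ : 4 = 2 * 2 :> R[i]); last by rewrite -natrM.
  by rewrite ler_pM// (le_trans _ K1).
rewrite (_ : L * _ * _ * _ = (L * L * (K - 1)) * s%:R); last by ring.
rewrite ler_wpM2r// (@le_trans _ _ (2 ^+ n * 2 ^+ n * (4 ^+ n)^-1))//.
  by rewrite !ler_pM ?mulr_ge0 ?subr_ge0.
by rewrite -exprMn -natrM mulfV// expf_neq0.
Qed.

Theorem fuglede (s p : nat) S P : adj_bound s%:R S -> adj_bound p%:R P ->
  GRing.comm P (adj_star P) -> GRing.comm S P -> GRing.comm S (adj_star P).
Proof.
move=> hS hP PP SP; apply: adjointable_eq => u; apply/esym/eqP.
rewrite -subr_eq0 -normr_eq0; apply/eqP.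
apply: (@le_div_nat_eq0 _ _ (5 * s%:R * `|u|)) => // r.
have [m hm] := fuglede_conj_bound r hS hP PP SP.
set w := adj_scal m.+1%:R^-1 * adj_star P in hm.
have := vpoly_1Dz_exp w m.+1 (vpoly_app S (vpoly_1Dz_exp (- w) m.+1 (vpoly_cst u))).
set c1 := (X in vpoly _ _ X).
(* The exponent [m.+1] cancels the denominator of [w]: the linear coefficient stays the same
   although [m] depends on [r]. *)
have c1E : c1 = (adj_star P * S) u - (S * adj_star P) u.
  have wm x : w x *+ m.+1 = adj_star P x.
    by rewrite /w adjEM/= -scaler_nat scalerA mulfV ?scale1r// pnatr_eq0.
  by rewrite /c1 add0r adjEN mulNrn wm !adjEM wm addrC -scaleN1r adjointableZ scaleN1r.
rewrite -c1E => /vpoly_coef1; apply => // z zr.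
by have := hm z zr u; rewrite !adjEM mulrN.
Qed.

End Fuglede.

(** * Unbounded operators handled through their bounded inverses *)

Section InverseOperators.
Context {R : realType} {H : hilbertType R}.
Implicit Types (A B T : operator H) (f g : adjointable H).
Local Open Scope operator_scope.

(** [A] is a bijection from [dom A] onto [H]. Taking [f] in the ring turns equalities of unbounded
    operators, domains included, into ring equations. *)
Definition is_inverse A f := [/\ forall y, dom A (f y),
  forall y, A (f y) = y & forall x, dom A x -> f (A x) = x].

Lemma bounded_adjointable A : dom A = setT -> bounded_op A ->
  exists f (n : nat), f =1 A /\ adj_bound n%:R f.
Proof.
move=> AT [M AM].
(* [M] is an arbitrary complex number, but its product with the norm of [x] dominates a norm, hence
   is nonnegative and unchanged when [M] is replaced by its modulus. *)
have [n Mn] := complex_archi (normr_ge0 M).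
have An x : `|A x| <= n%:R * `|x|.
  have /AM h : dom A x by rewrite AT.
  rewrite (le_trans h)// -[leLHS]ger0_norm ?(le_trans _ h)//.
  by rewrite normrM normr_id ler_wpM2r.
have /choice[F FP] : forall y, exists z, forall x, inner (A x) y = inner x z.
  move=> y; apply: (@riesz _ _ _ (n%:R * `|y|)).
    by move=> a x z; rewrite opfunP ?AT// innerDl innerZl.
  move=> x; rewrite (le_trans (cauchy_schwarz _ _))// mulrAC.
  by rewrite ler_wpM2r.
by exists (Adjointable (fun x y => FP y x)), n.
Qed.

Lemma invertible_inverse A : invertible A ->
  exists f (n : nat), is_inverse A f /\ adj_bound n%:R f.
Proof.
move=> [S [ST Sb [_ SA] [AST AS]]].
have [f [n [fS fn]]] := bounded_adjointable ST Sb.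
have domAS y : dom (A *op S) y by rewrite AST.
exists f, n; split => //; split => [y|y|x xA].
- by rewrite fS; have [] := domAS y.
- by rewrite fS; exact: (AS y).
have xSA : dom (S *op A) x by split; rewrite ?ST.
by rewrite fS -[RHS](AS x (domAS x)); exact: SA x xSA.
Qed.

(** For [x] in [dom A], [inner (A x) (adj_star f y) = inner (f (A x)) y = inner x y], so
    [adjoint dA] is defined at [adj_star f y] with value [y]. *)
Lemma is_inverse_adjoint A (dA : densely_defined A) f :
  is_inverse A f -> is_inverse (adjoint dA) (adj_star f).
Proof.
move=> [fA Af fAK].
have rel y : adj_rel A (adj_star f y) y.
  by move=> x xA; rewrite -adj_starP fAK.
have domA y : dom (adjoint dA) (adj_star f y) by exists y.
split => // [y|z zA]; first exact: (adj_rel_unique dA (adj_funP (domA y))).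
apply: inner_injr => x; rewrite -adj_starP -(adj_funP zA)//.
by rewrite Af.
Qed.

Lemma is_inverse_mul A B f g : is_inverse A f -> is_inverse B g ->
  is_inverse (B *op A) (f * g).
Proof.
move=> [fA Af fAK] [gB Bg gBK]; split => /= [y|y|x [xA xB]].
- by split; rewrite ?Af.
- by rewrite Af Bg.
- by rewrite gBK// fAK.
Qed.

Lemma is_inverse_eq A B f g : is_inverse A f -> is_inverse B g ->
  A =op B -> f = g.
Proof.
move=> [fA Af fAK] [gB Bg gBK] [AB ABE]; apply: adjointable_eq => y.
have fB : dom B (f y) by rewrite -AB.
by rewrite -[LHS]gBK// -ABE// Af.
Qed.

(** Both domains are the range of [f]. *)
Lemma is_inverse_inj A B f : is_inverse A f -> is_inverse B f -> A =op B.
Proof.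
move=> [fA Af fAK] [fB Bf fBK]; split => [|x xA].
  by apply/seteqP; split => x; [move=> /fAK <-|move=> /fBK <-].
by rewrite -[in RHS](fAK x xA) Bf.
Qed.

(** Inverting both sides of the normality equation reverses the products. *)
Lemma normal_inverse A f : is_inverse A f -> normal A ->
  GRing.comm f (adj_star f).
Proof.
move=> fA [dA [_ AA]]; have fA' := is_inverse_adjoint dA fA.
exact/esym/(is_inverse_eq (is_inverse_mul fA' fA) (is_inverse_mul fA fA') AA).
Qed.

Lemma adjointable_continuous f (n : nat) : adj_bound n%:R f -> continuous f.
Proof.
move=> fn x; apply/cvgrPdist_lt => e e0; near=> y.
rewrite -scaleN1r -adjointableZ -adjointableD scaleN1r.
rewrite (le_lt_trans (fn _))// (@le_lt_trans _ _ (n.+1%:R * `|x - y|))//.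
  by rewrite ler_wpM2r// ler_nat.
rewrite mulrC -ltr_pdivlMr//; near: y.
by apply: cvgr_dist_lt => //; rewrite divr_gt0.
Unshelve. all: by end_near. Qed.

(** The graph of [A] is the zero set of the continuous map sending [(x, y)] to [x - f y]. *)
Lemma is_inverse_closed A f (n : nat) : adj_bound n%:R f -> is_inverse A f ->
  closed_op A.
Proof.
move=> fM [fA Af fAK]; rewrite /closed_op.
rewrite (_ : [set _ | _] = (fun p : H * H => p.1 - f p.2) @^-1` [set 0]).
  apply: preimage_closed; last first.
    exact/accessible_closed_set1/hausdorff_accessible/norm_hausdorff.
  move=> p _; apply: cvgB; first exact: cvg_fst.
  apply: continuous_comp; first exact: cvg_snd.
  exact: (adjointable_continuous fM).
apply/seteqP; split => -[x y] /=.
  by move=> [xA ->]; rewrite fAK// subrr.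
move=> /eqP; rewrite subr_eq0 => /eqP ->.
by split; rewrite ?Af.
Qed.

Lemma is_inverse_normal A f (n : nat) : densely_defined A ->
  adj_bound n%:R f -> is_inverse A f -> GRing.comm f (adj_star f) -> normal A.
Proof.
move=> dA fM fA ff; exists dA; split; first exact: is_inverse_closed fM fA.
have fA' := is_inverse_adjoint dA fA.
apply: is_inverse_inj (is_inverse_mul fA' fA) _.
by rewrite -ff; exact: is_inverse_mul.
Qed.
End InverseOperators.

(** * Normality of the product of commuting invertible normal operators *)

Local Open Scope operator_scope.

Theorem corollary1 (R : realType) (H : hilbertType R) (A B : operator H)
    (dA : densely_defined A) (dB : densely_defined B)
    (iA : invertible A) (iB : invertible B)
    (nA : normal A) (nB : normal B)
    (dAB : forall T : operator H, product_of dA dB T -> densely_defined T)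
    (AB : B *op A =op A *op B) :
  normal (B *op A) /\ normal (A *op B).
Proof.
have [f [m [fA fm]]] := invertible_inverse iA.
have [g [n [gB gn]]] := invertible_inverse iB.
have fg := is_inverse_mul fA gB; have gf := is_inverse_mul gB fA.
(* [f * g] inverts [B *op A] and [g * f] inverts [A *op B], so the hypothesis on the products says
   that the inverses commute. *)
have fgC : GRing.comm f g := is_inverse_eq fg gf AB.
have ff := normal_inverse fA nA; have gg := normal_inverse gB nB.
have fg' : GRing.comm f (adj_star g) := fuglede fm gn gg fgC.
have gf' : GRing.comm g (adj_star f) := fuglede gn fm ff (commr_sym fgC).
(* Each of [f], [g] commutes with each of the two adjoints: [ff] and [gg] come from normality, [fg']
   and [gf'] from Fuglede. *)
have fgN : GRing.comm (f * g) (adj_star (f * g)).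
  rewrite adj_starM; apply: commrM.
    by apply/commr_sym/commrM; exact: commr_sym.
  by apply/commr_sym/commrM; exact: commr_sym.
have fgb : adj_bound (m * n)%:R (f * g) by rewrite natrM; exact: adj_boundM.
split; apply: is_inverse_normal fgb _ fgN => //.
- by apply: dAB; apply: product_of_mul; [exact: product_of_r|exact: product_of_l].
- by apply: dAB; apply: product_of_mul; [exact: product_of_l|exact: product_of_r].
- by rewrite fgC.
Qed.
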